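(* Let $c_n$ be the number of connected labelled graphs on $n$ vertices and $C(x)=\sum_nc_nx^n/n!$. Let $h_n$ be the number of labelled 2-graphs with $n$ vertices and $H(x)=\sum_nh_nx^n/n!$. Then, as formal power series, $$H(x)=C(xe^{-x})-x+\frac{x^2}{2}.$$ The same identity holds when $c_n$ and $h_n$ count only planar graphs.
   Context: All graphs are labelled and simple; generating functions are exponential. A 2-graph is a connected graph in which every vertex has degree at least two. *)

(* Defs.v *)
From mathcomp Require Import all_boot all_order all_algebra.
From mathcomp Require Import all_classical all_reals all_analysis.
Import Order.TTheory GRing.Theory Num.Theory.
Import numFieldNormedType.Exports.

Set Implicit Arguments.
Unset Strict Implicit.
Unset Printing Implicit Defensive.

Local Open Scope ring_scope.

(* A formal power series over rat is its sequence of coefficients, so addition,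
   opposite and scaling are the pointwise \+, \-, \*o of MathComp. *)
Definition fps := nat -> rat.

Definition fps_one : fps := fun n => (n == 0%N)%:R.
Definition fps_X : fps := fun n => (n == 1%N)%:R.
Definition fps_exp : fps := fun n => (n`!%:R)^-1.

Definition fps_mul (A B : fps) : fps :=
  fun n => \sum_(i < n.+1) A i * B (n - i)%N.

Definition fps_pow (A : fps) (k : nat) : fps := iter k (fps_mul A) fps_one.

(* A(B(x)).  Meaningful only when B has zero constant term: then B^k has no term
   of degree less than k, which is why the sum stops at k = n. *)
Definition fps_comp (A B : fps) : fps :=
  fun n => \sum_(k < n.+1) A k * fps_pow B k n.

Definition egf (a : nat -> nat) : fps := fun n => (a n)%:R / (n`!)%:R.

Section Graphs.
Variable V : finType.

(* A graph on V is given by its set of edges. *)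
Implicit Type E : {set {set V}}.

Definition simple_graph E : bool := [forall e in E, #|e| == 2%N].

Definition adj E : rel V := fun u v => [set u; v]%SET \in E.

Definition deg E (v : V) : nat := #|[pred u | adj E v u]|.

(* The graph without vertices does not count as connected. *)
Definition connected_graph E : bool :=
  [&& simple_graph E, (0 < #|V|)%N & [forall u, forall v, connect (adj E) u v]].

Definition two_graph E : bool :=
  connected_graph E && [forall v, (2 <= deg E v)%N].

(* p places the vertices and c e, restricted to [0, 1], is the Jordan arc
   drawing the edge e. *)
Definition plane_drawing (R : realType) E
    (p : V -> R * R) (c : {set V} -> R -> R * R) : Prop :=
  [/\ injective p,
      forall e, e \in E ->
        [/\ {within `[0, 1], continuous (c e)}%classic,
            {in `[0, 1] &, injective (c e)}
          & exists u v, [/\ e = [set u; v]%SET, c e 0 = p u & c e 1 = p v]],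
      forall e (t : R) w, e \in E -> t \in `]0, 1[ -> c e t <> p w
    & forall e e' (t t' : R), e \in E -> e' \in E -> e != e' ->
        t \in `]0, 1[ -> t' \in `]0, 1[ -> c e t <> c e' t'].

Definition planar (R : realType) E : bool :=
  `[< exists p c, @plane_drawing R E p c >].

End Graphs.

Definition num_connected (n : nat) : nat :=
  #|[pred E : {set {set 'I_n}} | connected_graph E]|.

Definition num_two (n : nat) : nat :=
  #|[pred E : {set {set 'I_n}} | two_graph E]|.

Definition num_planar_connected (R : realType) (n : nat) : nat :=
  #|[pred E : {set {set 'I_n}} | connected_graph E && planar R E]|.

Definition num_planar_two (R : realType) (n : nat) : nat :=
  #|[pred E : {set {set 'I_n}} | two_graph E && planar R E]|.

(* Main.v *)
(* On at least three vertices a 2-graph is a connected graph without leaves, so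
   inclusion-exclusion over the set S of prescribed leaves gives
     h_n = sum_S (-1)^|S| #{connected graphs in which all of S are leaves}.
   No two leaves of such a graph are adjacent, hence it is a connected graph on
   the complement of S together with a choice of neighbour for every s in S, and
     h_n = sum_k 'C(n, k) c_k (-k)^(n-k),
   which is n! times the coefficient of x^n in C(x e^{-x}).  The argument applies
   to every class of graphs that is stable under adding and deleting leaves.  For
   planar graphs, a leaf at p(a) is added by straightening the drawing: in a small
   ball around p(a), each arc leaving p(a) is replaced, up to its last exit from
   the ball, by the radius to the exit point, and a further radius is then free. *)

Require Import Defs.
From mathcomp Require Import all_boot all_order all_algebra.
From mathcomp Require Import ring lra.
From mathcomp Require Import all_classical all_reals all_analysis.
Import Order.TTheory GRing.Theory Num.Theory.
Import numFieldNormedType.Exports.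

Set Implicit Arguments.
Unset Strict Implicit.
Unset Printing Implicit Defensive.

Local Open Scope ring_scope.

(** * Connected graphs and their leaves *)

Section GraphOn.
Variable V : finType.
Implicit Types (E : {set {set V}}) (W S : {set V}).

(** The vertex set is a subset of a fixed type, so that a vertex can be deleted without changing the
    type. *)
Definition graph_on W E : bool :=
  [forall e in E, (#|e| == 2%N) && (e \subset W)].

Definition conn_on W E : bool :=
  [&& graph_on W E, W != finset.set0
    & [forall u in W, forall v in W, connect (adj E) u v]].

Definition leaves E : {set V} := [set v | deg E v == 1%N]%SET.

Lemma graph_onP W E :
  reflect (forall e, e \in E -> #|e| = 2%N /\ e \subset W) (graph_on W E).
Proof.
apply: (iffP forall_inP) => h e /h => [/andP[/eqP] //|[-> ->]].
by rewrite eqxx.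
Qed.

Lemma adj_sym E : symmetric (adj E).
Proof. by move=> u v; rewrite /adj finset.setUC. Qed.

Lemma adj_neq W E u v : graph_on W E -> adj E u v -> u != v.
Proof.
by move=> /graph_onP h /h[+ _]; rewrite cards2; case: (u != v).
Qed.

Lemma adj_in W E u v : graph_on W E -> adj E u v -> (u \in W) && (v \in W).
Proof.
move=> /graph_onP h /h[_ /fintype.subsetP s].
by rewrite !s ?finset.set21 ?finset.set22.
Qed.

Lemma leafP E s :
  reflect (exists a, forall u, adj E s u = (u == a)) (s \in leaves E).
Proof.
rewrite inE; apply: (iffP idP) => [|[a h]].
  have -> : deg E s = #|[set u | adj E s u]%SET|.
    by rewrite /deg; apply: eq_card => u; rewrite !inE.
  by case/cards1P => a /setP h; exists a => u; have := h u; rewrite !inE.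
by rewrite /deg -(card1 a); apply/eqP/eq_card => u; rewrite !inE h.
Qed.

Lemma conn_onT E : conn_on [set: V]%SET E = connected_graph E.
Proof.
rewrite /conn_on /connected_graph; congr [&& _, _ & _].
- apply: eq_forallb => e; rewrite finset.subsetT andbT //.
- by rewrite -finset.card_gt0 cardsT.
apply/forall_inP/forallP => [h u|h u _].
  apply/forallP => v; have /forall_inP := h u (finset.in_setT _).
  by apply; rewrite finset.in_setT.
by apply/forall_inP => v _; apply/forallP : v.
Qed.

End GraphOn.

(** An edge may go to a walk, possibly an empty one, so that [h] is allowed to contract edges. *)
Lemma connect_homo (A B : finType) (r : rel A) (r' : rel B) (h : A -> B) :
  (forall x y, r x y -> connect r' (h x) (h y)) ->
  forall x y, connect r x y -> connect r' (h x) (h y).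
Proof.
move=> hr x y /connectP[p + ->] {y}.
elim: p x => [|z p IHp] x //= /andP[/hr xz /IHp].
exact: connect_trans.
Qed.

Section Leaf.
Variable V : finType.
Implicit Types (E : {set {set V}}) (W S : {set V}).

Lemma conn_on_adj W E u : conn_on W E -> (1 < #|W|)%N -> u \in W ->
  exists v, adj E u v.
Proof.
case/and3P=> _ _ /forall_inP cE W2 uW.
have [v] : exists v, v \in W :\ u.
  by apply/card_gt0P; move: W2; rewrite (cardsD1 u W) uW.
rewrite !inE => /andP[vu vW]; have /forall_inP/(_ v vW) := cE u uW.
case/connectP => -[|w p] /=; first by move=> _ e; rewrite e eqxx in vu.
by case/andP => uw _ _; exists w.
Qed.

(** Each of [s] and [a] is the only neighbour of the other, so the pair is closed under adjacency
    and no walk from [s] leaves it. Hence leaves are never adjacent on three or more vertices. *)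
Lemma conn_on_leaf W E s a : conn_on W E -> s \in leaves E -> a \in leaves E ->
  adj E s a -> W \subset [set s; a]%SET.
Proof.
case/and3P=> gE _ /forall_inP cE sL aL sa.
have /andP[sW aW] := adj_in gE sa.
have cl x y : adj E x y -> (x \in [set s; a]%SET) -> (y \in [set s; a]%SET).
  case/leafP: sL => a' ha'; case/leafP: aL => s' hs' xy.
  move: (sa); rewrite ha' => /eqP aE.
  have := sa; rewrite adj_sym hs' => /eqP sE.
  rewrite !inE => /orP[] /eqP xE; move: xy; rewrite xE.
    by rewrite ha' -aE => ->; rewrite orbT.
  by rewrite hs' -sE => ->.
apply/fintype.subsetP => y yW; have /forall_inP/(_ y yW) := cE s sW.
case/connectP => p + ->; have: s \in [set s; a]%SET by rewrite finset.set21.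
elim: p {1 3 4}s => [|z p IHp] x //= xin /andP[xz].
by apply: IHp; apply: cl xz xin.
Qed.

Lemma adj_add E a s u v :
  adj ([set a; s]%SET |: E) u v =
  ([set u; v]%SET == [set a; s]%SET) || adj E u v.
Proof. by rewrite /adj !inE. Qed.

Lemma set2_eq (u v a s : V) : [set u; v]%SET == [set a; s]%SET ->
  (u = a /\ v = s) \/ (u = s /\ v = a).
Proof.
move=> /eqP /setP h.
have /orP hu : (u == a) || (u == s) by have := h u; rewrite !inE eqxx /=.
have /orP hv : (v == a) || (v == s) by have := h v; rewrite !inE eqxx orbT /=.
have /orP ha : (a == u) || (a == v) by have := h a; rewrite !inE eqxx /= => ->.
have /orP hs : (s == u) || (s == v).
  by have := h s; rewrite !inE eqxx orbT => ->.
case: hu => /eqP uE; case: hv => /eqP vE; rewrite uE vE; [|by left|by right|].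
- by left; case: hs => /eqP ->; rewrite ?uE ?vE.
- by left; case: ha => /eqP ->; rewrite ?uE ?vE.
Qed.

Lemma graph_on_widen W W' E : W \subset W' -> graph_on W E -> graph_on W' E.
Proof.
move=> s /graph_onP h; apply/graph_onP => e /h[-> eW]; split => //.
exact: fintype.subset_trans eW s.
Qed.

Lemma adj_add_other E a s u v : u != s -> v != s ->
  adj ([set a; s]%SET |: E) u v = adj E u v.
Proof.
move=> us vs; rewrite adj_add; case: eqP => // /eqP /set2_eq [[_ h]|[h _]].
  by rewrite h eqxx in vs.
by rewrite h eqxx in us.
Qed.

Lemma adj_add_new W E a s u : graph_on (W :\ s) E ->
  adj ([set a; s]%SET |: E) s u = (u == a).
Proof.
move=> gE; rewrite adj_add.
have -> : adj E s u = false.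
  by apply/negP => /(adj_in gE); rewrite !inE eqxx.
rewrite orbF; apply/eqP/eqP => [/eqP /set2_eq [[-> ->]|[]//]|->] //.
by rewrite finset.setUC.
Qed.

Lemma leaf_add W E a s : graph_on (W :\ s) E ->
  s \in leaves ([set a; s]%SET |: E).
Proof.
by move=> gE; apply/leafP; exists a => u; rewrite (adj_add_new _ _ gE).
Qed.

Lemma leaves_add W E a s v : graph_on (W :\ s) E -> v != a -> v != s ->
  (v \in leaves ([set a; s]%SET |: E)) = (v \in leaves E).
Proof.
move=> gE va vs; rewrite !inE; congr (_ == _); apply: eq_card => u.
rewrite !inE adj_add; case: eqP => // /eqP /set2_eq [[h _]|[h _]].
  by rewrite h eqxx in va.
by rewrite h eqxx in vs.
Qed.

(** The new edge is the only one at the leaf [s], so every edge of [E] avoids [s]. *)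
Lemma graph_on_add W E a s : s \in W -> a \in W :\ s ->
  graph_on W ([set a; s]%SET |: E) -> [set a; s]%SET \notin E ->
  s \in leaves ([set a; s]%SET |: E) -> graph_on (W :\ s) E.
Proof.
move=> sW aWs gE aE /leafP[a' ha]; apply/graph_onP => e eE.
have [e2 eW] : #|e| = 2%N /\ e \subset W.
  by apply: (graph_onP _ _ gE); rewrite !inE eE orbT.
split=> //; rewrite finset.subsetD1 eW /=; apply/negP => se.
have /cards2P[u [v [uv eq_e]]] : #|e| == 2%N by rewrite e2.
have aa' : a = a'.
  by apply/eqP; rewrite -ha adj_add finset.setUC eqxx.
have adjE w : e = [set s; w]%SET -> False.
  move=> eE'; have : adj ([set a; s]%SET |: E) s w.
    by rewrite adj_add /adj -eE' eE orbT.
  rewrite ha -aa' => /eqP wa; move: aE; rewrite -wa finset.setUC -eE' eE //.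
move: se; rewrite eq_e !inE => /orP[] /eqP sE.
  by apply: (adjE v); rewrite eq_e sE.
by apply: (adjE u); rewrite eq_e sE finset.setUC.
Qed.

Lemma conn_on_add W E a s : s \in W -> a \in W :\ s -> graph_on (W :\ s) E ->
  conn_on W ([set a; s]%SET |: E) = conn_on (W :\ s) E.
Proof.
move=> sW aWs gE; set E' := _ |: E.
have [as_ aW] : a != s /\ a \in W by move: aWs; rewrite !inE => /andP.
have gE' : graph_on W E'.
  apply/graph_onP => e; rewrite !inE => /orP[/eqP ->|].
    rewrite cards2 as_; split=> //; apply/fintype.subsetP => x; rewrite !inE.
    by case/orP => /eqP ->.
  by move/graph_onP: (graph_on_widen (finset.subsetDl W [set s]) gE); apply.
have sa : connect (adj E') s a by apply: connect1; rewrite (adj_add_new _ _ gE).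
have symE' := sym_connect_sym (@adj_sym _ E').
rewrite /conn_on gE gE' /=.
have -> : W != finset.set0 by apply/set0Pn; exists s.
have -> : W :\ s != finset.set0 by apply/set0Pn; exists a.
rewrite /=; apply/forall_inP/forall_inP => h u uW; apply/forall_inP => v vW.
- have [us vs] : u != s /\ v != s.
    by move: uW vW; rewrite !inE => /andP[? _] /andP[? _].
  have {h} : connect (adj E') u v.
    have /h/forall_inP : u \in W by move: uW; rewrite inE => /andP[].
    by apply; move: vW; rewrite inE => /andP[].
  (* Contracting the edge {a, s} to a turns walks of E' into walks of E. *)
  pose h x := if x == s then a else x.
  have -> : u = h u by rewrite /h (negbTE us).
  have -> : v = h v by rewrite /h (negbTE vs).
  have -> : connect (adj E') (h u) (h v) = connect (adj E') u v.
    by rewrite /h (negbTE us) (negbTE vs).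
  apply: connect_homo => x y; rewrite /h.
  case: (eqVneq x s) => [->|xs].
    rewrite (adj_add_new _ _ gE) => /eqP ->; rewrite (negbTE as_).
    exact: connect0.
  case: (eqVneq y s) => [->|ys].
    by rewrite adj_sym (adj_add_new _ _ gE) => /eqP ->; apply: connect0.
  by rewrite adj_add_other // => /connect1.
- have toE' x y : connect (adj E) x y -> connect (adj E') x y.
    apply: (connect_homo (h := id)) => ? ? xy; apply: connect1.
    by rewrite adj_add xy orbT.
  (* Every vertex reaches [a]: [s] by the new edge, the others already in [E]. *)
  have ca x : x \in W -> connect (adj E') x a.
    move=> xW; case: (eqVneq x s) => [->//|xs].
    by apply: toE'; apply: (forall_inP (h x _)) => //; rewrite !inE xs.
  apply: connect_trans (ca _ uW) _; rewrite symE'; exact: ca.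
Qed.

End Leaf.

(** * Counting *)

Section LeafCount.
Variables (V : finType) (Q : {set V} -> {set {set V}} -> bool).
Implicit Types (E : {set {set V}}) (W S : {set V}).
(** [Q] stands for the class of graphs to be counted, later all graphs or the planar ones; this is
    its stability under adding and deleting a leaf. *)
Hypothesis Q_leaf : forall W E a s, s \in W -> a \in W :\ s ->
  graph_on (W :\ s) E -> Q W ([set a; s]%SET |: E) = Q (W :\ s) E.

(** Vertices outside [S] may be leaves as well, as inclusion-exclusion requires. *)
Definition leafy_graphs W S : {set {set {set V}}} :=
  [set E | [&& conn_on W E, Q W E & S \subset leaves E]]%SET.

Lemma new_edge_notin W E a s : graph_on (W :\ s) E -> [set a; s]%SET \notin E.
Proof.
move=> /graph_onP h; apply/negP => /h[_ /fintype.subsetP/(_ s)].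
by rewrite !inE !eqxx orbT => /(_ isT).
Qed.

(** A graph with leaf [s] corresponds to the neighbour [a] of [s] together with the graph left after
    deleting [s]. The neighbour lies outside [S], since otherwise two adjacent leaves would exhaust
    [W] and [W :\: S] would be empty. *)
Lemma card_leafy_rec W S s : s \in S -> S \subset W -> W :\: S != finset.set0 ->
  #|leafy_graphs W S| =
  (#|W :\: S| * #|leafy_graphs (W :\ s) (S :\ s)|)%N.
Proof.
move=> sS SW /set0Pn[b bWS]; have sW : s \in W by apply: (fintype.subsetP SW).
rewrite -cardsX.
pose add (x : V * {set {set V}}) := [set x.1; s]%SET |: x.2.
have graphL W' S' E : E \in leafy_graphs W' S' -> graph_on W' E.
  by rewrite inE => /and3P[/and3P[]].
rewrite -(card_in_imset (f := add)).
  apply: eq_card => E; apply/idP/imsetP => [|[[a E'] + ->]].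
    move=> EL; have gE := graphL _ _ _ EL.
    move: EL; rewrite inE => /and3P[cE QE SL].
    have sL := fintype.subsetP SL s sS; case/leafP: (sL) => a ha.
    have sa : adj E s a by rewrite ha.
    have /andP[_ aW] := adj_in gE sa; have sa' := adj_neq gE sa.
    have aS : a \notin S.
      apply/negP => aS; have aL := fintype.subsetP SL a aS.
      have := fintype.subsetP (conn_on_leaf cE sL aL sa) b.
      move: bWS; rewrite !inE => /andP[bS bW] /(_ bW) /orP[] /eqP bE.
        by rewrite bE sS in bS.
      by rewrite bE aS in bS.
    have aWs : a \in W :\ s by rewrite !inE eq_sym sa'.
    have EE : [set a; s]%SET |: (E :\ [set a; s]%SET) = E.
      by apply: finset.setD1K; rewrite finset.setUC.
    exists (a, E :\ [set a; s]%SET); last by rewrite /add EE.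
    have gE' : graph_on (W :\ s) (E :\ [set a; s]%SET).
      by apply: graph_on_add aWs _ _ _; rewrite ?EE // !inE eqxx.
    rewrite finset.in_setX /= !inE aS aW /=.
    rewrite -(conn_on_add sW aWs gE') -(Q_leaf sW aWs gE') EE cE QE /=.
    apply/fintype.subsetP => x; rewrite !inE => /andP[xs xS].
    have xa : x != a by apply: contraNneq aS => <-.
    have /fintype.subsetP/(_ x xS) := SL.
    by rewrite -{1}EE (leaves_add gE' xa xs) inE.
  rewrite finset.in_setX /= => /andP[aWS E'L].
  have gE' := graphL _ _ _ E'L; move: aWS E'L; rewrite inE => /andP[aS aW].
  rewrite inE => /and3P[cE QE SL].
  have aWs : a \in W :\ s by rewrite !inE aW andbT; apply: contraNneq aS => ->.
  rewrite inE /add /= conn_on_add // Q_leaf // cE QE /=.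
  apply/fintype.subsetP => x xS; case: (eqVneq x s) => [->|xs].
    exact: leaf_add gE'.
  have xa : x != a by apply: contraNneq aS => <-.
  rewrite (leaves_add gE' xa xs); apply: (fintype.subsetP SL).
  by rewrite !inE xs.
(* Injectivity of [add]: [a] is recovered as the only neighbour of [s], and then [E] by deleting the
   new edge. *)
move=> [a E] [a' E']; rewrite !finset.in_setX /= => /andP[_ /graphL gE].
move=> /andP[_ /graphL gE']; rewrite /add /= => eqE.
have aa' : a = a'.
  by apply/eqP; rewrite -(adj_add_new a' a gE') -eqE (adj_add_new _ _ gE).
subst a'; congr (_, _).
rewrite -(finset.setU1K (new_edge_notin a gE)) eqE finset.setU1K //.
exact: new_edge_notin gE'.
Qed.

(** This is the case [S = W] left out by the recursion: some two vertices are adjacent, and as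
    adjacent leaves they would be all of [W]. *)
Lemma leafy_graphs_setT W : (2 < #|W|)%N -> leafy_graphs W W = finset.set0.
Proof.
move=> W2; apply/finset.setP => E; rewrite !inE; apply/negP.
case/and3P => cE _ /fintype.subsetP WL.
have [u uW] : exists u, u \in W by apply/card_gt0P; apply: leq_trans W2.
have [v uv] := conn_on_adj cE (ltnW W2) uW.
have gE : graph_on W E by case/and3P: cE.
have /andP[_ vW] := adj_in gE uv.
have /subset_leq_card := conn_on_leaf cE (WL u uW) (WL v vW) uv.
by rewrite cards2 leqNgt (leq_trans _ W2) //; case: (u != v).
Qed.

Lemma card_leafy W S : S \subset W -> W :\: S != finset.set0 ->
  #|leafy_graphs W S|
  = (#|leafy_graphs (W :\: S) finset.set0| * #|W :\: S| ^ #|S|)%N.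
Proof.
have [n] := ubnP #|S|; elim: n S W => // n IHn S W; rewrite ltnS => Sn SW WS.
have [S0|[s sS]] := set_0Vmem S.
  by rewrite S0 finset.setD0 cards0 expn0 muln1.
have DE : (W :\ s) :\: (S :\ s) = W :\: S.
  apply/finset.setP => x; rewrite !inE negb_and negbK.
  by case: (eqVneq x s) => [->|_] //=; rewrite sS.
rewrite (card_leafy_rec sS SW WS) IHn ?DE //.
- by rewrite (cardsD1 s S) sS expnS mulnCA.
- by move: Sn; rewrite (cardsD1 s S) sS.
- exact: finset.setSD.
Qed.

End LeafCount.

(** * Transport of graphs along injective relabellings *)

Section Relabel.
Variables (A B : finType) (h : A -> B).
Implicit Types (E : {set {set A}}) (W e : {set A}).

Definition relabel E : {set {set B}} := [set h @: e | e : {set A} in E]%SET.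

Lemma in_imset_inj W e e' : {in W &, injective h} -> e \subset W ->
  e' \subset W -> h @: e = h @: e' -> e = e'.
Proof.
move=> hI /fintype.subsetP eW /fintype.subsetP e'W /setP he.
apply/finset.setP => x; apply/idP/idP => xe.
  have : h x \in h @: e' by rewrite -he imset_f.
  by case/imsetP => y ye /hI -> //; auto.
have : h x \in h @: e by rewrite he imset_f.
by case/imsetP => y ye /hI -> //; auto.
Qed.

Lemma graph_on_relabel W E : {in W &, injective h} -> graph_on W E ->
  graph_on (h @: W) (relabel E).
Proof.
move=> hI /graph_onP gE; apply/graph_onP => _ /imsetP[e /gE[e2 eW] ->].
rewrite card_in_imset ?imsetS // => x y.
by move=> /(fintype.subsetP eW) ? /(fintype.subsetP eW) ?; apply: hI.
Qed.

Lemma conn_on_relabel W E : {in W &, injective h} -> conn_on W E ->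
  conn_on (h @: W) (relabel E).
Proof.
move=> hI /and3P[gE /set0Pn[w wW] /forall_inP cE]; apply/and3P; split.
- exact: graph_on_relabel.
- by apply/set0Pn; exists (h w); apply: imset_f.
apply/forall_inP => _ /imsetP[u uW ->]; apply/forall_inP => _ /imsetP[v vW ->].
apply: connect_homo (forall_inP (cE u uW) v vW) => x y xy; apply: connect1.
by apply/imsetP; exists [set x; y]%SET => //; rewrite imsetU1 imset_set1.
Qed.

End Relabel.

(** * Inclusion-exclusion over prescribed leaves *)

(** The left side is the product over all [v] of [1 - (v \in L)], and the sum over [S] is the
    expansion of this product. *)
Lemma eq_set0_alt (T : finType) (L : {set T}) : (L == finset.set0)%:R =
  \sum_(S : {set T}) (-1) ^+ #|S| * (S \subset L)%:R :> rat.
Proof.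
transitivity (\prod_v (- (v \in L)%:R + 1 : rat)).
  have [->|[v vL]] := set_0Vmem L.
    by rewrite eqxx big1 // => v _; rewrite inE oppr0 add0r.
  rewrite (bigD1 v) //= vL addNr mul0r; case: eqP vL => // ->.
  by rewrite inE.
rewrite bigA_distr; apply: eq_bigr => S _.
rewrite -big_mkcond /= prodrN; congr (_ * _).
have [/fintype.subsetP SL|] := boolP (S \subset L).
  by rewrite big1 // => v /SL ->.
case/subsetPn => v vS vL; rewrite (bigD1 v) //= (negbTE vL) mul0r //.
Qed.

Section Count.
Variable Q : forall V : finType, {set V} -> {set {set V}} -> bool.
Arguments Q {V}.
Hypothesis Q_relabel : forall (A B : finType) (h : A -> B) (W : {set A}) E,
  {in W &, injective h} -> graph_on W E -> Q W E -> Q (h @: W) (relabel h E).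

(** Relabelling is injective on graphs living on [W]. An inequality is enough, because it is applied
    below to an enumeration and to its inverse. *)
Lemma card_leafy0_le (A B : finType) (h : A -> B) (W : {set A}) :
  {in W &, injective h} ->
  (#|leafy_graphs Q W finset.set0|
    <= #|leafy_graphs Q (h @: W) finset.set0|)%N.
Proof.
move=> hI; rewrite -(card_in_imset (f := relabel h)).
  apply/subset_leq_card/fintype.subsetP => _ /imsetP[E + ->].
  rewrite !inE !finset.sub0set !andbT => /andP[cE QE].
  by rewrite conn_on_relabel //= Q_relabel //; case/and3P: cE.
have sub E : E \in leafy_graphs Q W finset.set0 -> E \subset powerset W.
  rewrite inE => /and3P[/and3P[/graph_onP gE _ _] _ _].
  by apply/fintype.subsetP => e /gE[_]; rewrite powersetE.
move=> E E' /sub EW /sub E'W; apply: in_imset_inj EW E'W => e e'.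
rewrite !powersetE; exact: in_imset_inj.
Qed.

Definition num_conn n := #|leafy_graphs Q [set: 'I_n] finset.set0|.

Lemma num_conn0 : num_conn 0 = 0%N.
Proof.
apply/eqP; rewrite cards_eq0; apply/eqP/finset.setP => E; rewrite !inE /conn_on.
by rewrite -[_ != finset.set0]card_gt0 cardsT card_ord andbF.
Qed.

Lemma card_leafy0 (V : finType) (U : {set V}) : 
  #|leafy_graphs Q U finset.set0| = num_conn #|U|.
Proof.
(* The inverse enumeration [enum_rank_in] needs an element of [U], so the empty set is treated
   apart. *)
have [->|[u uU]] := set_0Vmem U.
  rewrite cards0 num_conn0; apply/eqP; rewrite cards_eq0.
  by apply/eqP/finset.setP => E; rewrite !inE /conn_on eqxx andbF.
have fU : [set enum_val i | i in [set: 'I_#|U|]]%SET = U.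
  apply/finset.setP => x; apply/imsetP/idP => [[i _ ->]|xU].
    exact: enum_valP.
  by exists (enum_rank_in uU x) => //; rewrite enum_rankK_in.
have gU : [set enum_rank_in uU i | i in U]%SET = [set: 'I_#|U|]%SET.
  apply/finset.setP => i; rewrite inE; apply/imsetP.
  by exists (enum_val i); rewrite ?enum_valP ?enum_valK_in.
apply/eqP; rewrite eqn_leq; apply/andP; split.
  by rewrite /num_conn -gU; apply/card_leafy0_le/can_in_inj/(enum_rankK_in uU).
rewrite /num_conn -[X in (_ <= #|leafy_graphs _ X _|)%N]fU.
by apply: card_leafy0_le => i j _ _; apply: enum_val_inj.
Qed.

Definition num_leafless n :=
  #|[set E : {set {set 'I_n}} | two_graph E && Q [set: 'I_n] E]%SET|.

(** A connected graph has a vertex, and that vertex has at most [n - 1] neighbours. *)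
Lemma num_leafless_small n : (n <= 2)%N -> num_leafless n = 0%N.
Proof.
move=> n2; apply/eqP; rewrite cards_eq0; apply/eqP/finset.setP => E.
rewrite !inE; apply/negP => /andP[/andP[cE /forallP dE] _].
case/and3P: (cE) => _ /card_gt0P[v _] _.
have := dE v; apply/negP; rewrite -ltnNge.
have gE : graph_on finset.setT E by rewrite -conn_onT in cE; case/and3P: cE.
have : (deg E v <= #|predC1 v|)%N.
  apply/subset_leq_card/fintype.subsetP => u; rewrite !inE eq_sym.
  exact: adj_neq gE.
have := cardC1 v; rewrite card_ord => ->; move=> d.
by apply: leq_ltn_trans d _; case: n n2 {v E cE dE gE} => // n.
Qed.

Hypothesis Q_leaf : forall (V : finType) (W : {set V}) E a s,
  s \in W -> a \in W :\ s -> graph_on (W :\ s) E ->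
  Q W ([set a; s]%SET |: E) = Q (W :\ s) E.

Lemma num_leafless_large n : (2 < n)%N -> (num_leafless n)%:R =
  \sum_(k < n.+1) 'C(n, k)%:R * (num_conn k)%:R * (- k%:R) ^+ (n - k) :> rat.
Proof.
move=> n2; pose T : {set 'I_n} := [set: 'I_n]%SET.
have T2 : (2 < #|T|)%N by rewrite cardsT card_ord.
(* A connected graph on at least two vertices has no vertex of degree 0, so minimum degree two means
   absence of leaves. *)
have twoE E : two_graph E = conn_on T E && (leaves E == finset.set0).
  rewrite /two_graph conn_onT; case cE: (connected_graph E) => //=.
  apply/forallP/eqP => [dE|/finset.setP LE v].
    apply/finset.setP => v; rewrite !inE; have := dE v.
    by case: (deg E v) => [|[]].
  have [u vu] : exists u, adj E v u.
    by apply: (@conn_on_adj _ T); rewrite ?conn_onT // ltnW.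
  have : (0 < deg E v)%N by apply/card_gt0P; exists u.
  by have := LE v; rewrite !inE; case: (deg E v) => [|[]].
have -> : (num_leafless n)%:R =
    \sum_(E | conn_on T E && Q T E) (leaves E == finset.set0)%:R :> rat.
  rewrite /num_leafless -natr_sum -sum1_card.
  rewrite [in RHS]big_mkcond [in LHS]big_mkcond /=.
  congr (_%:R); apply: eq_bigr => E _; rewrite inE twoE andbAC.
  by case: (conn_on T E); case: (Q _ E); case: (_ == _).
under eq_bigr do rewrite eq_set0_alt.
rewrite exchange_big /=.
under eq_bigr => S _.
  rewrite -mulr_sumr.
  have -> : \sum_(E | conn_on T E && Q T E) (S \subset leaves E)%:R =
      #|leafy_graphs Q T S|%:R :> rat.
    rewrite -natr_sum -sum1_card [in RHS]big_mkcond [in LHS]big_mkcond /=.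
    congr (_%:R); apply: eq_bigr => E _; rewrite inE andbA.
    by case: (_ && _); case: (_ \subset _).
  have -> : #|leafy_graphs Q T S| =
      (num_conn #|~: S| * #|~: S| ^ #|S|)%N.
    (* If all vertices are prescribed leaves, both sides vanish, the right one through the factor
       [0 ^ #|T|]. *)
    have [->|ST] := eqVneq S T.
      rewrite leafy_graphs_setT // cards0 finset.setCT cards0.
      rewrite exp0n ?muln0 //; exact: ltnW (ltnW T2).
    rewrite card_leafy ?finset.subsetT ?finset.setTD ?card_leafy0 //.
      exact: Q_leaf.
    by apply: contraNneq ST => SC; rewrite -[S]finset.setCK SC finset.setC0.
  over.
(* From here [S] is the complement of the prescribed leaves, and the sum is grouped by its size [k].
   Here [inord] keeps the size, which is at most [n]. *)
rewrite (reindex_inj (inv_inj (@finset.setCK _))) /=.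
rewrite (partition_big (fun S : {set 'I_n} => inord #|S| : 'I_n.+1) xpredT) //=.
apply: eq_bigr => k _.
have cS (S : {set 'I_n}) : (inord #|S| == k) = (#|S| == k).
  by rewrite -val_eqE /= inordK // ltnS -[X in (_ <= X)%N]card_ord max_card.
under eq_bigl do rewrite cS.
rewrite (eq_bigr (fun _ => (num_conn k)%:R * (- k%:R) ^+ (n - k))); last first.
  move=> S /eqP Sk; have -> : #|~: S| = (n - k)%N.
    by rewrite -Sk -[X in (X - _)%N]card_ord -(cardsC S) addKn.
  by rewrite finset.setCK Sk natrM natrX (exprNn (k%:R : rat)) mulrCA.
rewrite (eq_bigl [in [set S : {set 'I_n} | #|S| == k]%SET]) => [|S]; last first.
  by rewrite inE.
by rewrite sumr_const card_draws card_ord -mulrA [RHS]mulr_natl.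
Qed.

Hypothesis Q_vertex : Q [set: 'I_1]%SET finset.set0.

Lemma num_conn1 : num_conn 1 = 1%N.
Proof.
apply/eqP/cards1P; exists finset.set0; apply/finset.setP => E.
rewrite !inE finset.sub0set andbT; apply/andP/eqP => [[/and3P[gE _ _] _]|->].
  have [//|[e /(graph_onP _ _ gE)[e2 _]]] := set_0Vmem E.
  by have := max_card [in e]; rewrite e2 card_ord.
split; last exact: Q_vertex.
apply/and3P; split; first by apply/graph_onP => e; rewrite inE.
- by rewrite -card_gt0 cardsT card_ord.
by apply/forall_inP => u _; apply/forall_inP => v _; rewrite (ord1 u) (ord1 v).
Qed.

(** In a connected graph on two vertices [ord0] is always a leaf, so prescribing it changes nothing
    and [card_leafy] reduces the count to one vertex. *)
Lemma num_conn2 : num_conn 2 = 1%N.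
Proof.
pose T : {set 'I_2} := [set: 'I_2]%SET.
have TE : T :\: [set ord0]%SET = [set ord_max]%SET.
  by apply/finset.setP => -[[|[]]] // i; rewrite !inE -!val_eqE.
rewrite /num_conn.
have <- : leafy_graphs Q T [set ord0]%SET = leafy_graphs Q T finset.set0.
  apply/finset.setP => E; rewrite !inE finset.sub0set.
  case cE: (conn_on T E) => //=; case: (Q T E) => //=.
  have gE : graph_on T E by case/and3P: cE.
  have [v sv] : exists v, adj E ord0 v.
    by apply: conn_on_adj cE _ _; rewrite ?inE // cardsT card_ord.
  rewrite finset.sub1set; apply/leafP; exists v => u.
  apply/idP/eqP => [su|-> //].
  have := adj_neq gE sv; have := adj_neq gE su; clear.
  case: u v => [[|[]]] // ? [[|[]]] // ?; rewrite -!val_eqE //= => _ _.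
  exact: val_inj.
rewrite card_leafy ?finset.subsetT //; last 2 first.
- exact: Q_leaf.
- by rewrite TE; apply/set0Pn; exists ord_max; rewrite inE.
by rewrite TE card_leafy0 !cards1 num_conn1.
Qed.

End Count.

(** * Powers of x exp(-x) *)

Definition fps_xexp : fps := fps_mul fps_X (fps_comp fps_exp (\- fps_X)).

(** The scalar [c] serves [x] and [-x] at once, with [c = 1] and [c = -1]. *)
Lemma fps_mulXl (c : rat) (A B : fps) n : (forall m, A m = c * fps_X m) ->
  fps_mul A B n = if n is m.+1 then c * B m else 0.
Proof.
move=> hA; rewrite /fps_mul; case: n => [|n].
  by rewrite big_ord_recl big_ord0 hA /fps_X mulr0 mul0r addr0.
rewrite big_ord_recl big_ord_recl big1 ?addr0 => [|i _].
  by rewrite !hA /fps_X /= mulr0 mul0r add0r mulr1 subn1.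
by rewrite hA /fps_X /= mulr0 mul0r.
Qed.

Lemma fps_pow_scaleX (c : rat) (A : fps) k n : (forall m, A m = c * fps_X m) ->
  fps_pow A k n = c ^+ k * (k == n)%:R.
Proof.
move=> hA; elim: k n => [|k IHk] n.
  by rewrite /fps_pow /= /fps_one expr0 mul1r eq_sym.
rewrite /fps_pow /= (fps_mulXl _ _ hA); case: n => [|n]; first by rewrite mulr0.
by rewrite -[iter _ _ _]/(fps_pow A k) IHk exprS mulrA.
Qed.

Lemma fps_expNX n : fps_comp fps_exp (\- fps_X) n = (-1) ^+ n / n`!%:R.
Proof.
have h m : (\- fps_X) m = -1 * fps_X m :> rat by rewrite mulN1r.
rewrite /fps_comp big_ord_recr /= (fps_pow_scaleX _ _ h) eqxx mulr1 mulrC.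
rewrite big1 ?add0r // => i _; rewrite (fps_pow_scaleX _ _ h).
by rewrite (ltn_eqF (ltn_ord i)) mulr0 mulr0.
Qed.

(** This is the expansion of [x^k e^{-kx}]; the induction step is the binomial theorem for
    [(-k - 1)^m]. *)
Lemma fps_pow_xexp k n : fps_pow fps_xexp k n =
  if (k <= n)%N then (- k%:R) ^+ (n - k) / (n - k)`!%:R else 0.
Proof.
have xexpE m : fps_xexp m = if m is j.+1 then (-1) ^+ j / j`!%:R else 0.
  rewrite /fps_xexp (@fps_mulXl 1) => [|j]; last by rewrite mul1r.
  by case: m => // m; rewrite mul1r fps_expNX.
elim: k n => [|k IHk] n.
  (* For [k = 0] the convention [0 ^+ 0 = 1] yields the constant series 1. *)
  rewrite /fps_pow /= /fps_one subn0 oppr0 expr0n; case: n => [|n] /=.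
    by rewrite fact0 divr1.
  by rewrite mul0r.
rewrite /fps_pow /= -[iter _ _ _]/(fps_pow fps_xexp k) /fps_mul.
rewrite big_ord_recl xexpE mul0r add0r; case: n => [|n].
  by rewrite big_ord0.
under eq_bigr do rewrite xexpE /= IHk /bump /= add1n subSS.
rewrite ltnS; case: leqP => kn; last first.
  rewrite big1 // => i _; rewrite leqNgt (leq_ltn_trans _ kn) ?leq_subr //=.
  by rewrite mulr0.
rewrite subSS; set m := (n - k)%N.
have fN0 j : j`!%:R != 0 :> rat by rewrite pnatr_eq0 -lt0n fact_gt0.
(* The terms with [n - i < k] vanish, so the convolution stops at [i = m]. *)
transitivity (\sum_(i < m.+1) (-1) ^+ i / i`!%:R *
    ((- k%:R) ^+ (m - i) / (m - i)`!%:R) : rat).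
  have le_mn : (m.+1 <= n.+1)%N by rewrite ltnS leq_subr.
  rewrite (big_ord_widen_cond _ (fun _ => true)
    (fun i => (-1) ^+ i / i`!%:R * ((- k%:R) ^+ (m - i) / (m - i)`!%:R)) le_mn).
  rewrite [RHS]big_mkcond /=; apply: eq_bigr => i _.
  have i_n : (i <= n)%N by rewrite -ltnS.
  have -> : (i < m.+1)%N = (k <= n - i)%N.
    by rewrite ltnS /m !leq_subRL // addnC.
  by case: ifP; rewrite ?mulr0 // /m subnAC.
rewrite -natr1 opprD exprDn mulr_suml; apply: eq_bigr => i _.
have im : (i <= m)%N by rewrite -ltnS.
apply: (canRL (mulfK (fN0 _))).
rewrite -(bin_fact im) (natrM _ 'C(m, i)) natrM -mulr_natr; field.
by rewrite !fN0.
Qed.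

(** The factor [n!] and the denominators [k!] and [(n-k)!] combine into the binomial coefficient;
    the right side is the inclusion-exclusion sum found for graphs without leaves. *)
Lemma fps_comp_xexp (a : nat -> nat) n : n`!%:R * fps_comp (egf a) fps_xexp n =
  \sum_(k < n.+1) 'C(n, k)%:R * (a k)%:R * (- k%:R) ^+ (n - k).
Proof.
rewrite /fps_comp mulr_sumr; apply: eq_bigr => k _.
have kn : (k <= n)%N by rewrite -ltnS.
have fN0 j : j`!%:R != 0 :> rat by rewrite pnatr_eq0 -lt0n fact_gt0.
rewrite fps_pow_xexp kn /egf -(bin_fact kn) (natrM _ 'C(n, k)) natrM; field.
by rewrite !fN0.
Qed.

(* The terms [- x + x^2/2] cancel the sum over [k] in degrees 1 and 2, where it
   equals 1 and -1 although [h] vanishes. *)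
Lemma egf_xexp (a h : nat -> nat) :
  (forall n, (2 < n)%N -> (h n)%:R =
     \sum_(k < n.+1) 'C(n, k)%:R * (a k)%:R * (- k%:R) ^+ (n - k) :> rat) ->
  (forall n, (n <= 2)%N -> h n = 0%N) -> a 0%N = 0%N -> a 1%N = 1%N ->
  a 2%N = 1%N ->
  egf h =1 fps_comp (egf a) fps_xexp \- fps_X \+ 2^-1 \*o fps_pow fps_X 2.
Proof.
move=> h_large h_small a0 a1 a2 n.
have fN0 : n`!%:R != 0 :> rat by rewrite pnatr_eq0 -lt0n fact_gt0.
have P2 m : fps_pow fps_X 2 m = (m == 2%N)%:R.
  by rewrite (@fps_pow_scaleX 1) ?expr1n ?mul1r 1?eq_sym // => j; rewrite mul1r.
set P := fps_pow _ _ in P2 *; apply: (mulfI fN0); rewrite /= /egf.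
rewrite mulrC mulfVK // !mulrDr fps_comp_xexp.
rewrite P2 /fps_X; case: (ltnP 2 n) => n2.
  rewrite h_large // (gtn_eqF n2) (gtn_eqF (ltnW n2)) /=.
  by ring.
rewrite h_small //; case: n n2 {fN0} => [|[|[|]]] // _;
  rewrite !big_ord_recl big_ord0 /= /bump /= a0 ?a1 ?a2.
- by ring.
- by apply/eqP; vm_compute.
- by apply/eqP; vm_compute.
Qed.

(** * Curves *)

Section RealFunctions.
Variable R : realType.
Implicit Types (f g : R -> R) (c : R -> R * R) (r s t : R).

(** Composition with this retraction turns an arc continuous within [[0, 1]] into a map continuous
    on the whole line. *)
Definition clamp t : R := Num.max 0 (Num.min t 1).

Lemma clamp_itv t : clamp t \in `[0, 1].
Proof.
by rewrite in_itv /= le_max lexx /= ge_max ler01 /= ge_min lexx orbT.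
Qed.

Lemma clamp_id t : t \in `[0, 1] -> clamp t = t.
Proof.
by rewrite in_itv /= => /andP[t0 t1]; rewrite /clamp (min_l t1) (max_r t0).
Qed.

Lemma continuous_maxr f g : continuous f -> continuous g ->
  continuous (fun t => Num.max (f t) (g t)).
Proof. by move=> cf cg t; exact: (@continuous_max R R f g t (cf t) (cg t)). Qed.

Lemma continuous_minr f g : continuous f -> continuous g ->
  continuous (fun t => Num.min (f t) (g t)).
Proof. by move=> cf cg t; exact: (@continuous_min R R f g t (cf t) (cg t)). Qed.

Lemma continuous_cst (T : topologicalType) (a : T) :
  continuous (fun _ : R => a).
Proof. by move=> t; exact: cvg_cst. Qed.

Lemma continuous_clamp : continuous clamp.
Proof.
apply: continuous_maxr; first exact: continuous_cst.
by apply: continuous_minr; [move=> t; exact: cvg_id | exact: continuous_cst].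
Qed.

Lemma continuous_comp_clamp (T : topologicalType) (c : R -> T) :
  {within `[0, 1], continuous c}%classic -> continuous (c \o clamp).
Proof.
move=> cg t U; have Dt := clamp_itv t.
move=> Ut; have : within `[0, 1]%classic (nbhs (clamp t)) (c @^-1` U)%classic.
  by rewrite nbhs_subspace_in //; exact: cg Ut.
move=> /continuous_clamp h.
apply: (@filterS _ (nbhs t) _ _ _ _ h) => u hu; exact: hu (clamp_itv u).
Qed.

(** [T] is the supremum of the times in [[0, 1]] with [f t <= r]. Continuity gives [f T <= r], and
    were it strict, the intermediate value theorem on [[T, 1]] would yield a later time with value
    [r]. *)
Lemma last_exit f r : continuous f -> f 0 < r -> r < f 1 ->
  exists T, [/\ 0 < T, T < 1, f T = r & forall t, T < t -> t <= 1 -> r < f t].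
Proof.
move=> cf f0 f1.
pose A : set R := [set t | (0 <= t <= 1) && (f t <= r)]%classic.
have A0 : A 0 by rewrite /A /= lexx ler01 ltW.
have supA : has_sup A.
  by split; [exists 0 | exists 1 => t /andP[/andP[]]].
have ubA := sup_upper_bound supA.
set T := sup A in ubA *.
have T0 : 0 <= T by exact: ubA.
have T1 : T <= 1 by apply: ge_sup => [|t /andP[/andP[]//]]; exists 0.
have after t : T < t -> t <= 1 -> r < f t.
  move=> Tt t1; rewrite ltNge; apply/negP => ft.
  suff /ubA : A t by rewrite leNgt Tt.
  by rewrite /A /= t1 ft (le_trans T0 (ltW Tt)).
have fT_le : f T <= r.
  rewrite leNgt; apply/negP => rfT.
  have /cvgrPdist_lt/(_ (f T - r)) := cf T; rewrite subr_gt0 => /(_ rfT).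
  move=> /nbhs_ballP[d /= d0 hd].
  have [t At Tt] := sup_adherent d0 supA.
  have /hd : ball T d t.
    rewrite /ball /= ger0_norm ?subr_ge0 ?ubA //; move: Tt; rewrite -/T; lra.
  move=> /=; rewrite ltr_norml; case/andP: At => _ ftr; lra.
have T_lt1 : T < 1.
  by rewrite lt_neqAle T1 andbT; apply: contraTneq f1 => TE; rewrite -leNgt -TE.
have fT : f T = r.
  apply/eqP; rewrite eq_le fT_le leNgt; apply/negP => fTr.
  have cfT : {within `[T, 1], continuous f}%classic.
    exact: continuous_subspaceT.
  have [|t] := IVT (v := r) T1 cfT.
    by rewrite ge_min le_max fT_le /= (ltW f1) orbT.
  rewrite in_itv /= => /andP[Tt t1] ftr.
  have : T < t.
    rewrite lt_neqAle Tt andbT; apply: contraTneq fTr => ->.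
    by rewrite ftr ltxx.
  by move=> /after/(_ t1); rewrite ftr ltxx.
exists T; split=> //; rewrite lt_neqAle T0 andbT.
by apply: contraTneq f0 => ->; rewrite fT ltxx.
Qed.

Lemma finite_min (T : finType) (P : T -> R -> Prop) :
  (forall x r r', P x r -> 0 < r' -> r' <= r -> P x r') ->
  (forall x, exists2 r, 0 < r & P x r) -> exists2 r, 0 < r & forall x, P x r.
Proof.
move=> down hP.
suff [r r0 hr] : exists2 r, 0 < r & forall x, x \in enum T -> P x r.
  by exists r => // x; apply: hr; rewrite mem_enum.
elim: (enum T) => [|y l [r r0 IHl]]; first by exists 1.
have [r' r'0 hy] := hP y; exists (Num.min r r'); first by rewrite lt_min r0.
move=> x; rewrite inE => /orP[/eqP ->|/IHl hx].
  by apply: down hy _ _; rewrite ?lt_min ?r0 // ge_min lexx orbT.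
by apply: down hx _ _; rewrite ?lt_min ?r0 // ge_min lexx.
Qed.

(** The distance to [q] has a positive minimum on the compact interval; half of it is a strict lower
    bound. *)
Lemma away_from_curve c (q : R * R) : continuous c ->
  (forall t, t \in `[0, 1] -> c t <> q) ->
  exists2 r, 0 < r & forall t, t \in `[0, 1] -> r < `|c t - q|.
Proof.
move=> cc cq; pose f t := `|c t - q|.
have cf : continuous f.
  move=> t; apply: (@cvg_norm _ _ _ _ _ (fun t => c t - q)).
  by apply: cvgB; [exact: cc | exact: cvg_cst].
have cf01 : {within `[0, 1], continuous f}%classic.
  exact: continuous_subspaceT.
have [t t01 ft] := EVT_min ler01 cf01.
have ft0 : 0 < f t by rewrite normr_gt0 subr_eq0; apply/eqP/cq.
exists (f t / 2); first by rewrite divr_gt0.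
move=> u /ft; rewrite /f in ft0 *; lra.
Qed.

(* For D = c s - q, the curve runs along the segment from q to c s until time s
   and follows c afterwards. *)
Lemma continuous_straighten c s (D : R * R) : continuous c ->
  continuous (fun t => c (Num.max t s) + (Num.min (t / s) 1 - 1) *: D).
Proof.
move=> cc t; apply: cvgD.
  apply: (continuous_comp (f := fun t => Num.max t s)); last exact: cc.
  apply: continuous_maxr; last exact: continuous_cst.
  by move=> u; exact: cvg_id.
apply: cvgZr_tmp; apply: cvgB; last exact: cvg_cst.
apply: (@continuous_minr (fun t => t / s) (fun=> 1)).
  exact: mulrr_continuous.
exact: continuous_cst.
Qed.

(** It gives room for a new number: any positive number below [d] lies outside [l]. *)
Lemma gap_right_of_0 (l : seq R) :
  exists2 d, 0 < d & forall x, x \in l -> 0 < x -> d <= x.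
Proof.
elim: l => [|y l [d d0 IHl]]; first by exists 1.
case: (ltP 0 y) => y0; last first.
  exists d => // x; rewrite inE => /orP[/eqP ->|/IHl //].
  by rewrite ltNge y0.
exists (Num.min d y); first by rewrite lt_min d0.
move=> x; rewrite inE ge_min => /orP[/eqP -> _|/IHl h /h ->//].
by rewrite lexx orbT.
Qed.

End RealFunctions.

(** * Plane drawings *)

Section PlanarOn.
Variable R : realType.

(** Unlike in [plane_drawing], arcs are continuous on the whole line and only the positions of
    vertices in [W] are constrained. *)
Definition drawing_on (V : finType) (W : {set V}) (E : {set {set V}})
    (p : V -> R * R) (c : {set V} -> R -> R * R) : Prop :=
  [/\ {in W &, injective p},
      forall e, e \in E ->
        [/\ continuous (c e),
            {in `[0, 1] &, injective (c e)}
          & exists u v, [/\ e = [set u; v]%SET, c e 0 = p u & c e 1 = p v]],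
      forall e (t : R) w, e \in E -> t \in `]0, 1[ -> w \in W -> c e t <> p w
    & forall e e' (t t' : R), e \in E -> e' \in E -> e != e' ->
        t \in `]0, 1[ -> t' \in `]0, 1[ -> c e t <> c e' t'].

Definition planar_on (V : finType) (W : {set V}) (E : {set {set V}}) : bool :=
  `[< exists p c, drawing_on W E p c >].

Lemma itv01_oo_cc (t : R) : t \in `]0, 1[ -> t \in `[0, 1].
Proof. exact: subset_itv_oo_cc. Qed.

Lemma planar_onT (V : finType) (E : {set {set V}}) :
  planar_on [set: V]%SET E = planar R E.
Proof.
apply: asbool_equiv_eq; split=> -[p [c [pI cE cp cc]]]; exists p.
  exists c; split=> //.
  - by move=> u v; apply: pI; rewrite inE.
  - move=> e /cE[ce cI cuv]; split=> //; exact: continuous_subspaceT.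
  by move=> e t w eE t01; apply: cp; rewrite ?inE.
exists (fun e => c e \o @clamp R).
have clampE e (t : R) : t \in `[0, 1] -> (c e \o @clamp R) t = c e t.
  by move=> t01; rewrite /= clamp_id.
split.
- by move=> u v _ _; apply: pI.
- move=> e /cE[ce cI [u [v [eE c0 c1]]]]; split.
  + exact: continuous_comp_clamp.
  + move=> t t' t01 t'01; rewrite !clampE //; exact: cI.
  + by exists u, v; rewrite !clampE // in_itv /= lexx ler01.
- by move=> e t w eE t01 _; rewrite clampE ?itv01_oo_cc //; apply: cp.
move=> e e' t t' eE e'E ee' t01 t'01.
by rewrite !clampE ?itv01_oo_cc //; apply: cc.
Qed.

Lemma planar_on_relabel (A B : finType) (h : A -> B) (W : {set A}) E :
  {in W &, injective h} -> graph_on W E -> planar_on W E ->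
  planar_on (h @: W) (relabel h E).
Proof.
move=> hI /graph_onP gE /asboolP[p [c [pI cE cp cc]]]; apply/asboolP.
(* Since [h] is injective on [W] only, points and edges are pulled back within [W]; a point outside
   [h @: W] gets the dummy position 0. *)
pose p' y := if [pick x in W | h x == y] is Some x then p x else 0.
pose c' (e : {set B}) := c (W :&: h @^-1: e).
have p'E x : x \in W -> p' (h x) = p x.
  move=> xW; rewrite /p'; case: pickP => [y /andP[yW /eqP /hI ->] //|/(_ x)].
  by rewrite xW eqxx.
have c'E e : e \in E -> c' (h @: e) = c e.
  move=> /gE[_ /fintype.subsetP eW]; congr c.
  apply/finset.setP => x; rewrite !inE.
  apply/andP/idP => [[xW /imsetP[y ye /hI ->//]]|xe]; first exact: eW.
  by rewrite eW // imset_f.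
exists p', c'; split.
- by move=> _ _ /imsetP[x xW ->] /imsetP[y yW ->]; rewrite !p'E // => /pI ->.
- move=> _ /imsetP[e eE ->]; rewrite c'E //.
  have [ce cI [u [v [euv c0 c1]]]] := cE e eE; split=> //; exists (h u), (h v).
  have [_ /fintype.subsetP eW] := gE e eE.
  rewrite !p'E ?eW ?euv ?finset.set21 ?finset.set22 //.
  by rewrite imsetU1 imset_set1 -euv.
- move=> _ t _ /imsetP[e eE ->] t01 /imsetP[w wW ->].
  by rewrite c'E // p'E //; apply: cp.
move=> _ _ t t' /imsetP[e eE ->] /imsetP[e' e'E ->] ee'; rewrite !c'E //.
by apply: cc => //; apply: contraNneq ee' => ->.
Qed.

Lemma planar_on_vertex (V : finType) (W : {set V}) : (#|W| <= 1)%N ->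
  planar_on W finset.set0.
Proof.
move=> W1; apply/asboolP; exists (fun=> 0), (fun _ _ => 0).
split=> [u v uW vW _|e|e t w|e e' t t']; rewrite ?inE //.
exact: (card_le1_eqP W1).
Qed.

Lemma planar_on_sub (V : finType) (W W' : {set V}) (E E' : {set {set V}}) :
  W' \subset W -> E' \subset E -> planar_on W E -> planar_on W' E'.
Proof.
move=> /fintype.subsetP sW /fintype.subsetP sE /asboolP[p [c [pI cE cp cc]]].
apply/asboolP; exists p, c; split.
- by move=> u v /sW ? /sW ?; apply: pI.
- by move=> e /sE /cE.
- by move=> e t w /sE eE t01 /sW; apply: cp.
- by move=> e e' t t' /sE eE /sE; apply: cc.
Qed.

(** An arc at [a] that does not start at [p a] is run backwards, so that the last exit from a ball
    around [p a] makes sense for every arc at [a]. *)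
Lemma drawing_on_orient (V : finType) (W : {set V}) E (a : V) p c :
  a \in W -> graph_on W E -> drawing_on W E p c ->
  exists c', drawing_on W E p c' /\
    forall e, e \in E -> a \in e ->
      exists v, [/\ e = [set a; v]%SET, v \in W, v != a, c' e 0 = p a
                  & c' e 1 = p v].
Proof.
move=> aW /graph_onP gE [pI cE cp cc].
pose rv (e : {set V}) := (a \in e) && (c e 0 != p a).
pose c' e := if rv e then c e \o (fun t : R => 1 - t) else c e.
have itv_oo (t : R) : t \in `]0, 1[ -> 1 - t \in `]0, 1[.
  by rewrite !in_itv /= => /andP[? ?]; lra.
have itv_cc (t : R) : t \in `[0, 1] -> 1 - t \in `[0, 1].
  by rewrite !in_itv /= => /andP[? ?]; lra.
have cont : continuous (fun t : R => 1 - t).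
  by move=> t; apply: cvgB; [exact: cvg_cst | exact: cvg_id].
exists c'; split; first split=> //.
- move=> e eE; have [ce cI [u [v [euv c0 c1]]]] := cE e eE.
  rewrite /c'; case: (rv e); last by split=> //; exists u, v.
  split.
  + by move=> t; apply: continuous_comp; [exact: cont | exact: ce].
  + move=> t t' /itv_cc t01 /itv_cc t'01 /= /(cI _ _ t01 t'01); lra.
  + by exists v, u; rewrite /= subr0 subrr c0 c1 finset.setUC.
- move=> e t w eE t01 wW; rewrite /c'; case: (rv e); last exact: cp.
  by apply: cp => //; exact: itv_oo.
- move=> e e' t t' eE e'E ee' t01 t'01.
  by rewrite /c'; case: (rv e); case: (rv e') => /=;
    apply: cc; rewrite // itv_oo.
move=> e eE ae; have [_ _ [u [v [euv c0 c1]]]] := cE e eE.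
have [e2 /fintype.subsetP eW] := gE e eE.
have uW : u \in W by rewrite eW // euv finset.set21.
have vW : v \in W by rewrite eW // euv finset.set22.
have uv : u != v by move: e2; rewrite euv cards2; case: (u != v).
move: (ae); rewrite {1}euv !inE => /orP[] /eqP aE.
  by exists v; rewrite /c' /rv ae aE c0 eqxx eq_sym.
have pu : p u != p a by apply: contra_neq uv; rewrite aE => /pI ->.
exists u; rewrite /c' /rv c0 ae pu /= subr0 subrr c0 c1 aE uW uv.
by split=> //; rewrite finset.setUC.
Qed.

Lemma planar_on_add (V : finType) (W : {set V}) E (a s : V) :
  s \in W -> a \in W :\ s -> graph_on (W :\ s) E -> planar_on (W :\ s) E ->
  planar_on W ([set a; s]%SET |: E).
Proof.
move=> sW aWs gE /asboolP[p [c0 /(drawing_on_orient aWs gE)[c [+ cor]]]].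
move=> [pI cE cp cc]; pose e0 : {set V} := [set a; s]%SET.
have as_ : a != s by move: aWs; rewrite !inE => /andP[].
have e0E : e0 \notin E by exact: new_edge_notin gE.
(* The ball of radius [r1] contains no other vertex, and that of radius [r2] meets no arc of an edge
   avoiding [a]. In both, the radius 1 is a dummy for vacuous cases. *)
have [r1 r10 hr1] : exists2 r, 0 < r & forall w, w \in W :\ s -> w != a ->
    r < `|p w - p a|.
  apply: finite_min => [w r r' h r'0 r'r wW wa|w].
    exact: le_lt_trans r'r (h wW wa).
  case: (eqVneq (p w) (p a)) => [pw|pw].
    by exists 1 => // wW; rewrite (pI _ _ wW aWs pw) eqxx.
  have n0 : 0 < `|p w - p a| by rewrite normr_gt0 subr_eq0.
  by exists (`|p w - p a| / 2) => [|_ _]; lra.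
have [r2 r20 hr2] : exists2 r, 0 < r & forall e, e \in E -> a \notin e ->
    forall t, t \in `[0, 1] -> r < `|c e t - p a|.
  apply: finite_min => [e r r' h r'0 r'r eE ae t t01|e].
    exact: le_lt_trans r'r (h eE ae t t01).
  have [/andP[eE ae]|nh] := boolP ((e \in E) && (a \notin e)); last first.
    by exists 1 => // eE ae; rewrite eE ae in nh.
  have [ce _ [u [v [euv c0' c1]]]] := cE e eE.
  have [_ /fintype.subsetP eW] := graph_onP _ _ gE e eE.
  have vne x : x \in e -> p x <> p a.
    move=> xe /pI xa; move: ae; rewrite -xa ?xe //; exact: eW.
  have [|r r0 hr] := away_from_curve (q := p a) ce; last by exists r.
  move=> t; rewrite in_itv /= => /andP[t0 t1].
  have [->|tn0] := eqVneq t 0.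
    by rewrite c0'; apply: vne; rewrite euv finset.set21.
  have [->|tn1] := eqVneq t 1.
    by rewrite c1; apply: vne; rewrite euv finset.set22.
  by apply: cp => //; rewrite in_itv /= !lt_neqAle t0 t1 eq_sym tn0 tn1.
pose r := Num.min r1 r2; have r0 : 0 < r by rewrite lt_min r10.
have {}hr1 w : w \in W :\ s -> w != a -> r < `|p w - p a|.
  by move=> wW wa; rewrite gt_min hr1.
have {}hr2 e t : e \in E -> a \notin e -> t \in `[0, 1] -> r < `|c e t - p a|.
  by move=> eE ae t01; rewrite gt_min hr2 // orbT.
clearbody r.
(* [T0 e] is the time of the last exit from the ball, for the edges at [a]. *)
have /choice[T0 hT0] : forall e, exists T, e \in E -> a \in e ->
    [/\ 0 < T, T < 1, `|c e T - p a| = r &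
      forall t, T < t -> t <= 1 -> r < `|c e t - p a|].
  move=> e.
  have [/andP[eE ae]|nh] := boolP ((e \in E) && (a \in e)); last first.
    by exists 0 => eE ae; rewrite eE ae in nh.
  have [v [_ vW va ca cv]] := cor e eE ae; have [ce _ _] := cE e eE.
  have [||| T hT] := @last_exit R (fun t => `|c e t - p a|) r.
  - by move=> t; apply: cvg_norm; apply: cvgB; [exact: ce | exact: cvg_cst].
  - by rewrite ca subrr normr0.
  - by rewrite cv hr1.
  by exists T.
pose D0 e := c e (T0 e) - p a.
(* The direction of the new edge gets a positive second coordinate at most [d0 / 2], which no exit
   vector has. *)
have [d0 d00 hd0] := gap_right_of_0 [seq (D0 e).2 | e <- enum E].
(* In the max norm of R * R, d lies on the sphere of radius r. *)
pose d : R * R := (r, Num.min (d0 / 2) r).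
have dr : `|d| = r.
  rewrite prod_normE /= (gtr0_norm r0) gtr0_norm ?lt_min ?r0 ?divr_gt0 //.
  by rewrite max_l // ge_min lexx orbT.
have dD e : e \in E -> D0 e <> d.
  move=> eE De; have : d0 <= (D0 e).2.
    apply: hd0; first by apply/mapP; exists e; rewrite ?mem_enum.
    by rewrite De /= lt_min r0 divr_gt0.
  by rewrite De /= le_min => /andP[h _]; lra.
(* T e is the time up to which the new arc of e is a radius of the ball; it is
   negative for the edges that do not meet a, whose arcs stay outside. *)
pose T e := if e == e0 then 1 else if a \in e then T0 e else -1.
pose D e := if e == e0 then d else D0 e.
pose c' e := if e == e0 then fun t => p a + t *: d else if a \in e then
  fun t => c e (Num.max t (T0 e)) + (Num.min (t / T0 e) 1 - 1) *: D0 e else c e.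
pose p' w := if w == s then p a + d else p w.
have EE e : e \in e0 |: E -> e != e0 -> e \in E.
  by rewrite !inE => /orP[/eqP -> /[!eqxx]|].
(* Different edges with the same exit point would cross at the interior times [T0 e] and [T0 e']. *)
have ccT e e' : e \in E -> e' \in E -> a \in e -> a \in e' ->
    D0 e = D0 e' -> e = e'.
  move=> eE e'E ae ae' /addIr eqc; apply/eqP/negP => /negP ee'.
  have [T0e T1e _ _] := hT0 e eE ae; have [T0e' T1e' _ _] := hT0 e' e'E ae'.
  by apply: (cc e e' (T0 e) (T0 e')) eqc; rewrite ?in_itv /= ?T0e ?T0e'.
have Dinj e e' : e \in e0 |: E -> e' \in e0 |: E -> 0 < T e -> 0 < T e' ->
    D e = D e' -> e = e'.
  move=> /EE eE /EE e'E; rewrite /T /D.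
  have [->|ne] := eqVneq e e0; have [->|ne'] := eqVneq e' e0 => //.
  - by move=> _ _ /esym /dD; case; exact: e'E.
  - by move=> _ _ /dD; case; exact: eE.
  case: ifP => ae; last by rewrite ltrNr oppr0 ltr10.
  case: ifP => ae'; last by rewrite ltrNr oppr0 ltr10.
  by move=> _ _; apply: ccT; auto.
(* Each point of a new arc is either on a radius, within distance [r] of [p a], or on the old arc,
   strictly farther than [r]. Points of different kinds never coincide; those on radii are compared
   by distance and direction, the others by the old drawing. *)
have phase e t : e \in e0 |: E -> t \in `[0, 1] ->
    [/\ 0 < T e, t <= T e, c' e t = p a + (t / T e) *: D e
      & `|c' e t - p a| = t / T e * r] \/
    [/\ T e < t, e \in E, c' e t = c e t & r < `|c' e t - p a|].
  move=> /EE eE /[dup] t01; rewrite in_itv /= => /andP[t0 t1].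
  rewrite /T /D /c'; have [->|ne] := eqVneq e e0.
    left; rewrite divr1 addrAC subrr add0r normrZ dr (ger0_norm t0).
    by split.
  have {}eE := eE ne; case: ifP => ae; last first.
    right; split=> //; first by rewrite (lt_le_trans _ t0) // ltrN10.
    by apply: hr2; rewrite ?ae.
  have [T0e T1e Tr Tafter] := hT0 e eE ae.
  have [tT|Tt] := leP t (T0 e).
    left; rewrite min_l ?ler_pdivrMr ?mul1r //.
    have -> : c e (T0 e) + (t / T0 e - 1) *: D0 e = p a + (t / T0 e) *: D0 e.
      rewrite -[c e (T0 e)](subrK (p a)) -/(D0 e) scalerBl scale1r.
      by rewrite [D0 e + _]addrC -addrA [_ - D0 e]addrC addNKr.
    by rewrite addrAC subrr add0r normrZ Tr ger0_norm // divr_ge0 // ltW.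
  right; rewrite min_r ?ler_pdivlMr ?mul1r ?(ltW Tt) //.
  by rewrite subrr scale0r addr0; split=> //; apply: Tafter.
have e0T : T e0 = 1 by rewrite /T eqxx.
have e0D : D e0 = d by rewrite /D eqxx.
have e0in : e0 \in e0 |: E by rewrite !inE eqxx.
have itvP (t : R) : t \in `]0, 1[ -> 0 < t /\ t < 1.
  by rewrite in_itv /= => /andP.
have nearE (x y : R) : 0 < y -> x <= y -> x / y * r <= r.
  by move=> y0 xy; apply: ler_piMl; rewrite ?(ltW r0) // ler_pdivrMr // mul1r.
apply/asboolP; exists p', c'; split.
- move=> u v uW vW; rewrite /p'.
  (* The new vertex is at distance exactly [r] from [p a], every old one at distance 0 or more than
     [r]. *)
  have dpw w : w \in W -> w != s -> p w <> p a + d.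
    move=> wW ws pw; have wWs : w \in W :\ s by rewrite !inE ws.
    have [wa|wa] := eqVneq w a.
      move: dr; rewrite -[d](addKr (p a)) -pw wa addNr normr0 => /esym/eqP.
      by rewrite gt_eqF.
    by have := hr1 w wWs wa; rewrite pw addrAC subrr add0r dr ltxx.
  have [->|us] := eqVneq u s; have [->|vs] := eqVneq v s => //.
  - by move=> /esym /dpw; case.
  - by move=> /dpw; case.
  by move=> /pI; rewrite !inE us vs; apply.
- move=> e eE'; split.
  + rewrite /c'; have [_|ne] := eqVneq e e0.
      move=> t; apply: cvgD; first exact: cvg_cst.
      by apply: cvgZr_tmp; exact: cvg_id.
    have [ce _ _] := cE e (EE e eE' ne).
    by case: ifP => // ae; exact: continuous_straighten.
  + move=> t t' t01 t'01 eqc.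
    case: (phase e t eE' t01) => [[Te tT _ nt]|[Te eE ct nt]];
    case: (phase e t' eE' t'01) => [[Te' tT' _ nt']|[Te' _ ct' nt']].
    * move: nt'; rewrite -eqc nt => /(mulIf (lt0r_neq0 r0)).
      by move=> /(mulIf (invr_neq0 (lt0r_neq0 Te))).
    * by move: nt'; rewrite -eqc nt ltNge nearE.
    * by move: nt; rewrite eqc nt' ltNge nearE.
    by have [_ cI _] := cE e eE; apply: cI; rewrite // -ct -ct'.
  have [->|ne] := eqVneq e e0.
    exists a, s; rewrite /c' /p' !eqxx (negbTE as_) scale0r addr0 scale1r.
    by split.
  have eE := EE e eE' ne; have [ae|ae] := boolP (a \in e); last first.
    have [_ _ [u [v [euv cu cv]]]] := cE e eE.
    have [_ /fintype.subsetP eW] := graph_onP _ _ gE e eE.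
    exists u, v; rewrite /c' /p' (negbTE ne) (negbTE ae); split=> //.
      by have := eW u; rewrite {1}euv !inE eqxx => /(_ isT)/andP[/negbTE ->].
    by have := eW v; rewrite {1}euv !inE eqxx orbT => /(_ isT)/andP[/negbTE ->].
  have [v [eav vW va ca cv]] := cor e eE ae.
  have vs : v != s by move: vW; rewrite !inE => /andP[].
  exists a, v; rewrite /p' (negbTE as_) (negbTE vs); split=> //.
    have [|[_ _ -> _]|[_ _ -> _]] := phase e 0 eE' => //.
      by rewrite in_itv /= lexx ler01.
    by rewrite mul0r scale0r addr0.
  have [|[_ T1 _ _]|[_ _ -> _]] := phase e 1 eE' => //.
    by rewrite in_itv /= lexx ler01.
  have [_ T01 _ _] := hT0 e eE ae.
  by move: T1; rewrite /T (negbTE ne) ae leNgt T01.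
- move=> e t w eE' t01 wW eqw; have [t0 t1] := itvP t t01.
  have := phase e t eE' (itv01_oo_cc t01); rewrite eqw /p'.
  (* An arc through the new vertex is at distance [r] in direction [d], so [t = T e] and [e = e0];
     but then [t = 1], an endpoint. *)
  have [ws|ws] := eqVneq w s.
    rewrite addrAC subrr add0r dr.
    case=> [[Te tT /addrI De nt]|[_ _ _]]; last first.
      by rewrite ltxx.
    have tTe : t = T e.
      move: nt; rewrite -{1}[r]mul1r => /(mulIf (lt0r_neq0 r0)) /esym.
      by move=> /(canRL (divfK (lt0r_neq0 Te))); rewrite mul1r.
    move: De; rewrite -tTe divff ?lt0r_neq0 // scale1r -e0D => /esym De.
    have ee0 : e = e0 by apply: Dinj De; rewrite ?e0T.
    by move: t1; rewrite tTe ee0 e0T ltxx.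
  have wWs : w \in W :\ s by rewrite !inE ws.
  have [-> |wa] := eqVneq w a; rewrite ?subrr ?normr0.
    case=> [[Te _ _] /esym/eqP|[_ _ _]]; last by rewrite ltNge ltW.
    by rewrite gt_eqF // !mulr_gt0 ?invr_gt0.
  case=> [[Te tT _ nt]|[_ eE ct _]].
    by have := hr1 w wWs wa; rewrite nt ltNge nearE.
  by apply: (cp e t w eE t01 wWs); rewrite -ct.
- move=> e e' t t' eE' e'E' ee' t01 t'01 eqc.
  have [t0 t1] := itvP t t01; have [t0' t1'] := itvP t' t'01.
  case: (phase e t eE' (itv01_oo_cc t01)) => [[Te tT ct nt]|[Te eE ct nt]];
  case: (phase e' t' e'E' (itv01_oo_cc t'01)) =>
    [[Te' tT' ct' nt']|[Te' e'E ct' nt']].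
  (* Equal distances from [p a] mean equal fractions of the two radii; these are nonzero, so the
     directions agree and the edges coincide. *)
  + have q : t / T e = t' / T e'.
      by apply: (mulIf (lt0r_neq0 r0)); rewrite -nt -nt' eqc.
    move/eqP: ee'; apply; apply: Dinj => //.
    have q0 : t / T e != 0 by rewrite lt0r_neq0 // divr_gt0.
    by apply: (scalerI q0); apply: (addrI (p a)); rewrite -ct eqc ct' q.
  + by move: nt'; rewrite -eqc nt ltNge nearE.
  + by move: nt; rewrite eqc nt' ltNge nearE.
  by apply: (cc e e' t t') => //; rewrite -ct -ct'.
Qed.

End PlanarOn.

Lemma planar_on_leaf (R : realType) (V : finType) (W : {set V}) E (a s : V) :
  s \in W -> a \in W :\ s -> graph_on (W :\ s) E ->
  planar_on R W ([set a; s]%SET |: E) = planar_on R (W :\ s) E.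
Proof.
move=> sW aWs gE; apply/idP/idP; last exact: planar_on_add.
by apply: planar_on_sub; rewrite ?finset.subsetDl ?finset.subsetUr.
Qed.

(** * The identity for leaf-stable classes and its two instances *)

Lemma leafless_egf (Q : forall V : finType, {set V} -> {set {set V}} -> bool) :
  (forall (A B : finType) (h : A -> B) (W : {set A}) E,
     {in W &, injective h} -> graph_on W E -> Q A W E ->
     Q B (h @: W) (relabel h E)) ->
  (forall (V : finType) (W : {set V}) E a s, s \in W -> a \in W :\ s ->
     graph_on (W :\ s) E -> Q V W ([set a; s]%SET |: E) = Q V (W :\ s) E) ->
  Q _ [set: 'I_1]%SET finset.set0 ->
  egf (num_leafless Q) =1
    fps_comp (egf (num_conn Q)) fps_xexp \- fps_X \+ 2^-1 \*o fps_pow fps_X 2.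
Proof.
move=> Q_relabel Q_leaf Q_vertex; apply: egf_xexp.
- by move=> n; apply: num_leafless_large.
- by move=> n; apply: num_leafless_small.
- exact: num_conn0.
- exact: num_conn1.
- exact: num_conn2.
Qed.

Theorem theorem7 :
  (egf num_two =1
     fps_comp (egf num_connected) (fps_mul fps_X (fps_comp fps_exp (\- fps_X)))
       \- fps_X \+ 2^-1 \*o fps_pow fps_X 2)
  /\
  (forall R : realType,
     egf (num_planar_two R) =1
     fps_comp (egf (num_planar_connected R))
         (fps_mul fps_X (fps_comp fps_exp (\- fps_X)))
       \- fps_X \+ 2^-1 \*o fps_pow fps_X 2).
Proof.
(* Series are compared pointwise, so the counts have to be exchanged explicitly inside [egf] and
   [fps_comp]. *)
have egf_eq a a' : a =1 a' -> egf a =1 egf a' by move=> e n; rewrite /egf e.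
have comp_eq A A' B : A =1 A' -> fps_comp A B =1 fps_comp A' B.
  by move=> e n; apply: eq_bigr => k _; rewrite e.
have transfer Q c h : h =1 num_leafless Q -> num_conn Q =1 c ->
    egf (num_leafless Q) =1
      fps_comp (egf (num_conn Q)) fps_xexp
        \- fps_X \+ 2^-1 \*o fps_pow fps_X 2 ->
    egf h =1 fps_comp (egf c) fps_xexp \- fps_X \+ 2^-1 \*o fps_pow fps_X 2.
  move=> hE cE H n; rewrite (egf_eq _ _ hE) H /=.
  by rewrite (comp_eq _ _ _ (egf_eq _ _ cE)).
split=> [|R].
  apply: (transfer (fun _ _ _ => true)) => [n|n|].
  - by apply: eq_card => E; rewrite !inE andbT.
  - by apply: eq_card => E; rewrite !inE conn_onT finset.sub0set !andbT.
  by apply: leafless_egf.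
apply: (transfer (@planar_on R)) => [n|n|].
- by apply: eq_card => E; rewrite !inE planar_onT.
- by apply: eq_card => E; rewrite !inE conn_onT planar_onT finset.sub0set andbT.
apply: leafless_egf.
- exact: planar_on_relabel.
- exact: planar_on_leaf.
by apply: planar_on_vertex; rewrite cardsT card_ord.
Qed.
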